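(* Let $n\ge1$, let $P=\{p_1,\dots,p_n\}$ be worker performance rates with $0<p_i\le1$, let $\alpha\in\mathbb{R}$ be a threshold, let $\Omega\subseteq(0,\infty)$ be the domain of the job values, and let $f:\Omega\times P\to\mathbb{R}$ be order-preserving in the argument of $P$. For each $i=1,\dots,n$ let $$u_i=\max\{x\in\Omega:\ f(x,p_i)\ge\alpha\},\qquad v_i=\min\{x\in\Omega:\ f(x,p_i)\ge\alpha\}$$ (assumed to exist), and put $M=\{u_1,\dots,u_n\}$, $N=\{v_1,\dots,v_n\}$. Let $X=\{x_1,\dots,x_n\}$ be job values in $\Omega$, and let $r(X)$ be the value of the threshold reward obtained when the jobs are assigned sequentially by the optimal policy $\pi^*$. Then $$r(X)=n\ \Longrightarrow\ l(N)\le l(X)\le l(M),$$ where $l$ denotes the job load.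
   Context: Order-preserving: $f:\Omega\times P\to\mathbb{R}$ is order-preserving in the argument of $P$ if the order of the values $f(x,p_1),\dots,f(x,p_n)$ does not depend on $x\in\Omega$; that is, for all $x,x'\in\Omega$ and $p,q\in P$, $f(x,p)\le f(x,q)$ if and only if $f(x',p)\le f(x',q)$. Job load: for values $y_1,\dots,y_n$ (regarded as an $n$-tuple, repetitions counted), $l(\{y_1,\dots,y_n\})=\sqrt{y_1^2+\dots+y_n^2}$. Reward: $r(X)=\max_{\pi}\sum_{i=1}^{n}\mathbf{1}_{\{\sum_{j=1}^{n}A_{ij}f(x_i,p_j)\ge\alpha\}}$, the maximum over assignments $\pi=(A_{ij})$ with $A_{ij}\in\{0,1\}$, $\sum_jA_{ij}\le1$ for all $i$, $\sum_iA_{ij}\le1$ for all $j$; a job assigned to no worker is rejected and contributes $0$, so the reward counts jobs $i$ assigned to some worker $j$ with $f(x_i,p_j)\ge\alpha$. Policy $\pi^*$: jobs arrive in the order $x_1,\dots,x_n$; each arriving $x_i$ is assigned to a not-yet-assigned worker $j$ whose rate minimizes $f(x_i,p)$ subject to $f(x_i,p)\ge\alpha$ over the rates $p$ of not-yet-assigned workers (ties broken arbitrarily), and is rejected if no such worker exists. This policy attains the maximum $r(X)$. *)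

(* Defs.v *)
From mathcomp Require Import all_boot all_order all_algebra.
From mathcomp Require Import classical_sets reals.

Set Implicit Arguments.
Unset Strict Implicit.
Unset Printing Implicit Defensive.

Import Order.TTheory GRing.Theory Num.Theory.
Local Open Scope classical_set_scope.
Local Open Scope ring_scope.

(* [f] is only ever evaluated on [Omega * P]; its values elsewhere are
   irrelevant. *)
Definition order_preserving (R : realType) (Omega P : set R)
    (f : R -> R -> R) : Prop :=
  forall x x', Omega x -> Omega x' -> forall p q, P p -> P q ->
    (f x p <= f x q <-> f x' p <= f x' q).

Definition is_max (R : realType) (E : set R) (m : R) : Prop :=
  E m /\ ubound E m.

Definition is_min (R : realType) (E : set R) (m : R) : Prop :=
  E m /\ lbound E m.

(* Finite collections of values are families indexed by ['I_n], so that
   repetitions are counted. *)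
Definition job_load (R : realType) (n : nat) (y : 'I_n -> R) : R :=
  Num.sqrt (\sum_i y i ^+ 2).

(* [A i j] means that job [i] is assigned to worker [j]. *)
Definition is_assignment (n : nat) (A : 'M[bool]_n) : bool :=
  [forall i, (\sum_j A i j <= 1)%N] && [forall j, (\sum_i A i j <= 1)%N].

(* The first conjunct makes a rejected job contribute 0 even when
   [alpha <= 0], in which case the empty sum reaches the threshold. *)
Definition served (R : realType) (n : nat) (p : 'I_n -> R) (alpha : R)
    (f : R -> R -> R) (x : 'I_n -> R) (A : 'M[bool]_n) (i : 'I_n) : bool :=
  [exists j, A i j] && (alpha <= \sum_j (A i j)%:R * f (x i) (p j)).

Definition threshold_reward (R : realType) (n : nat) (p : 'I_n -> R)
    (alpha : R) (f : R -> R -> R) (x : 'I_n -> R) (A : 'M[bool]_n) : nat :=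
  (\sum_(i < n) served p alpha f x A i)%N.

Definition max_reward (R : realType) (n : nat) (p : 'I_n -> R)
    (alpha : R) (f : R -> R -> R) (x : 'I_n -> R) : nat :=
  (\max_(A : 'M[bool]_n | is_assignment A) threshold_reward p alpha f x A)%N.

(* Worker [j] is not yet assigned when job [i] arrives, and meets the
   threshold on it; only the rows of [A] before [i] matter. *)
Definition eligible (R : realType) (n : nat) (p : 'I_n -> R) (alpha : R)
    (f : R -> R -> R) (x : 'I_n -> R) (A : 'M[bool]_n) (i j : 'I_n) : Prop :=
  (forall k : 'I_n, (k < i)%N -> ~~ A k j) /\ alpha <= f (x i) (p j).

(* [A] is a possible outcome of the sequential policy on the jobs
   [x 0], ..., [x n.-1]; this is a relation because ties are broken
   arbitrarily. *)
Definition pi_star (R : realType) (n : nat) (p : 'I_n -> R) (alpha : R)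
    (f : R -> R -> R) (x : 'I_n -> R) (A : 'M[bool]_n) : Prop :=
  is_assignment A /\
  forall i : 'I_n,
    (forall j, A i j ->
       eligible p alpha f x A i j /\
       (forall j', eligible p alpha f x A i j' ->
          f (x i) (p j) <= f (x i) (p j'))) /\
    ((exists j, eligible p alpha f x A i j) -> exists j, A i j).

Lemma sum_bool_card (I : finType) (b : I -> bool) :
  (\sum_i b i)%N = #|finset b|.
Proof.
rewrite -sum1_card [RHS]big_mkcond /=; apply: eq_bigr => i _.
by rewrite inE; case: (b i).
Qed.

Lemma sum_bool_le1P (I : finType) (b : I -> bool) :
  reflect (forall i j, b i -> b j -> i = j) (\sum_i b i <= 1)%N.
Proof.
rewrite sum_bool_card.
apply: (iffP card_le1_eqP) => h i j; last by rewrite !inE => bi bj; apply: h.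
by move=> bi bj; apply: h; rewrite inE.
Qed.

Lemma is_assignmentP (n : nat) (A : 'M[bool]_n) :
  reflect ((forall i j j', A i j -> A i j' -> j = j') /\
           (forall j i i', A i j -> A i' j -> i = i')) (is_assignment A).
Proof.
apply: (iffP andP) => -[h1 h2]; split.
- by move=> i; apply/sum_bool_le1P; move/forallP: h1; apply.
- by move=> i; apply/sum_bool_le1P; move/forallP: h2; apply.
- by apply/forallP => i; apply/sum_bool_le1P; exact: h1.
- by apply/forallP => i; apply/sum_bool_le1P; exact: h2.
Qed.

Lemma servedP (R : realType) (n : nat) (p : 'I_n -> R) (alpha : R)
    (f : R -> R -> R) (x : 'I_n -> R) (A : 'M[bool]_n) (i : 'I_n) :
  is_assignment A ->
  reflect (exists j, A i j /\ alpha <= f (x i) (p j))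
    (served p alpha f x A i).
Proof.
move=> /is_assignmentP[rowA _].
have sumE j : A i j -> \sum_k (A i k)%:R * f (x i) (p k) = f (x i) (p j).
  move=> Aij; rewrite (bigD1 j) //= Aij mul1r big1 ?addr0 // => k kj.
  case Aik: (A i k); last by rewrite mul0r.
  by rewrite (rowA _ _ _ Aik Aij) eqxx in kj.
apply: (iffP andP) => [[/existsP[j Aij]]|[j [Aij le_a]]].
  by rewrite (sumE j Aij) => le_a; exists j.
by rewrite (sumE j Aij); split => //; apply/existsP; exists j.
Qed.

Lemma leq_card_rel (T : finType) (e : T -> T -> bool) (X Y : {set T}) :
  (forall a, a \in X -> exists2 b, b \in Y & e a b) ->
  (forall a a' b, e a b -> e a' b -> a = a') -> (#|X| <= #|Y|)%N.
Proof.
move=> ex inj.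
pose g a := odflt a [pick b in Y | e a b].
have gP a : a \in X -> g a \in Y /\ e a (g a).
  move=> /ex[b bY eab]; rewrite /g; case: pickP => [c /andP[]|/(_ b)] //=.
  by rewrite bY eab.
have g_inj : {in X &, injective g}.
  move=> a a' /gP[_ ea] /gP[_ ea'] E; apply: (inj _ _ (g a)) => //.
  by rewrite E.
rewrite -(finset.card_in_imset g_inj); apply: fintype.subset_leq_card.
by apply/fintype.subsetP => _ /finset.imsetP[a /gP[gY _] ->].
Qed.

(* The sequential policy attains the maximal reward, whatever the ties. *)
Lemma pi_star_max_reward (R : realType) (n : nat) (p : 'I_n -> R)
    (alpha : R) (Omega : set R) (f : R -> R -> R) (x : 'I_n -> R)
    (A : 'M[bool]_n) :
  order_preserving Omega (range p) f -> (forall i, Omega (x i)) ->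
  pi_star p alpha f x A ->
  threshold_reward p alpha f x A = max_reward p alpha f x.
Proof.
move=> fP Ox [asA stepA]; apply/eqP; rewrite eqn_leq; apply/andP; split.
  by rewrite /max_reward (bigD1 A) //= leq_maxl.
apply/bigmax_leqP => B asB.
rewrite /threshold_reward !sum_bool_card.
set SB := finset _; set SA := finset _.
have ordP i i' j k :
    (f (x i) (p j) <= f (x i) (p k)) = (f (x i') (p j) <= f (x i') (p k)).
  have P k0 : range p (p k0) by exists k0.
  by apply/idP/idP; apply (fP _ _ (Ox _) (Ox _) _ _ (P _) (P _)).
have [rowA colA] := is_assignmentP _ asA.
have [rowB colB] := is_assignmentP _ asB.
have SAP i j : A i j -> i \in SA.
  move=> Aij; rewrite inE; apply/(servedP p alpha f x i asA); exists j.
  by split => //; have [/(_ j Aij)[[]]] := stepA i.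
suff [D [U [DSA UA UB]]] : exists D U : {set 'I_n},
    [/\ D \subset SA,
        forall w, w \in U -> exists2 i, i \notin D & A i w &
        forall i, i \notin D -> i \in SB -> exists2 j, j \in U & B i j].
  rewrite -(finset.cardsID D SB) -(finset.cardsID D SA) (finset.setIidPr DSA).
  apply: leq_add; first by apply: fintype.subset_leq_card; apply: finset.subsetIr.
  apply: (@leq_trans #|U|).
    apply: (leq_card_rel (e := fun i j => B i j)) => [i|a a' b Ba Ba'].
      by rewrite inE => /andP[]; exact: UB.
    exact: colB Ba Ba'.
  apply: (leq_card_rel (e := fun j i => A i j)) => [w /UA[i iD Aiw]|a a' b].
    by exists i => //; rewrite inE iD (SAP _ _ Aiw).
  exact: rowA.
have [full|] := boolP [forall j, exists i, A i j].
  exists finset.set0, finset.setT; split; first exact: finset.sub0set.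
    move=> w _; move/forallP: full => /(_ w)/existsP[i Ai].
    by exists i; rewrite ?inE.
  move=> i _; rewrite inE => /(servedP p alpha f x i asB)[j [Bij _]].
  by exists j; rewrite ?inE.
rewrite negb_forall => /existsP[d0 d0P].
(* [d] is an idle worker of largest rate *)
pose F j := f (x d0) (p j).
pose d := [arg max_(j > d0 | ~~ [exists i, A i j]) F j]%O.
have [dP dmax] : ~~ [exists i, A i d] /\
    (forall j, ~~ [exists i, A i j] -> F j <= F d).
  by rewrite /d; case: arg_maxP.
exists (finset (fun i => alpha <= f (x i) (p d))).
exists (finset (fun j => F d < F j)); split.
- apply/fintype.subsetP => i; rewrite inE => le_a.
  have [_ ex] := stepA i; have [|j Aij] := ex; last exact: SAP Aij.
  exists d; split => // k _; apply: contra dP => Akd.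
  by apply/existsP; exists k.
- move=> w; rewrite inE => ltw.
  have : [exists i, A i w].
    by apply: contraLR ltw => /dmax; rewrite -leNgt.
  move=> /existsP[i Aiw]; exists i => //; rewrite inE.
  apply/negP => le_a; have [/(_ _ Aiw)[_ /(_ d) mind] _] := stepA i.
  move: ltw; rewrite ltNge /F (ordP d0 i) mind //.
  split => // k _; apply: contra dP => Akd.
  by apply/existsP; exists k.
- move=> i; rewrite !inE => Na /(servedP p alpha f x i asB)[j [Bij le_a]].
  exists j => //; rewrite inE ltNge /F (ordP d0 i).
  by apply: contra Na; exact: le_trans.
Qed.

Lemma pi_star_exists (R : realType) (n : nat) (p : 'I_n -> R) (alpha : R)
    (f : R -> R -> R) (x : 'I_n -> R) :
  exists A : 'M[bool]_n, pi_star p alpha f x A.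
Proof.
suff /(_ n (leqnn n)) [A [asA stepA _]] : forall m, (m <= n)%N ->
    exists A : 'M[bool]_n, [/\ is_assignment A,
      (forall i : 'I_n, (i < m)%N ->
        (forall j, A i j -> eligible p alpha f x A i j /\
          (forall j', eligible p alpha f x A i j' ->
             f (x i) (p j) <= f (x i) (p j'))) /\
        ((exists j, eligible p alpha f x A i j) -> exists j, A i j)) &
      forall i j : 'I_n, (m <= i)%N -> ~~ A i j].
  by exists A; split => // i; apply: stepA.
elim=> [_|m IH ltmn].
  exists (const_mx false); split => //.
    by apply/is_assignmentP; split => ? ? ?; rewrite mxE.
  by move=> i j _; rewrite mxE.
have [A [asA stepA emA]] := IH (ltnW ltmn).
have [rowA colA] := is_assignmentP _ asA.
pose i0 := Ordinal ltmn.
pose el j := [forall k, ~~ A k j] && (alpha <= f (x i0) (p j)).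
have extE (C : 'M[bool]_n) (i : 'I_n) :
    (forall k : 'I_n, (k < m)%N -> forall j, C k j = A k j) -> (i <= m)%N ->
    forall j, eligible p alpha f x C i j <-> eligible p alpha f x A i j.
  move=> CA lei j; split=> -[h1 h2]; split=> // k ki; have := h1 k ki;
    by rewrite CA // (leq_trans ki).
have elP j : reflect (eligible p alpha f x A i0 j) (el j).
  apply: (iffP andP) => -[h1 h2]; split => //.
    by move=> k _; move/forallP: h1; apply.
  by apply/forallP => k; case: (ltnP k m) => [/h1|/emA].
have [j0 elj0|noel] := pickP el; last first.
  exists A; split => // [i|i j /ltnW/emA //].
  rewrite ltnS leq_eqVlt => /orP[/eqP im|/stepA //].
  have {im}-> : i = i0 by apply: val_inj.
  split=> [j Aij|[j /elP]]; last by rewrite noel.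
  by have := emA i0 j (leqnn _); rewrite Aij.
pose j1 := [arg min_(j < j0 | el j) f (x i0) (p j)]%O.
have [elj1 minj1] : el j1 /\ (forall j, el j ->
    f (x i0) (p j1) <= f (x i0) (p j)) by rewrite /j1; case: arg_minP.
pose C : 'M[bool]_n := \matrix_(i, j) (A i j || (i == i0) && (j == j1)).
have CA (k : 'I_n) : (k < m)%N -> forall j, C k j = A k j.
  move=> km j; rewrite mxE; case: eqP => [E|]; last by rewrite orbF.
  by move: km; rewrite E ltnn.
have Ci0 j : C i0 j = (j == j1).
  by rewrite mxE eqxx (negbTE (emA i0 j (leqnn m))).
have Nj1 k : A k j1 = false.
  by have /andP[/forallP/(_ k)/negbTE] := elj1.
exists C; split.
- apply/is_assignmentP; split.
    move=> i j j'; case: (eqVneq i i0) => [->|ni].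
      by rewrite !Ci0 => /eqP-> /eqP->.
    by rewrite !mxE (negbTE ni) /= !orbF; exact: rowA.
  move=> j i i'; case: (eqVneq j j1) => [->|nj].
    by rewrite !mxE !Nj1 /= eqxx !andbT => /eqP-> /eqP->.
  by rewrite !mxE (negbTE nj) !andbF !orbF; exact: colA.
- move=> i; rewrite ltnS leq_eqVlt => /orP[/eqP im|im].
    have -> : i = i0 by apply: val_inj.
    split=> [j|_]; last by exists j1; rewrite Ci0.
    rewrite Ci0 => /eqP->; split.
      by apply/(extE C i0 CA (leqnn _)); apply/elP.
    by move=> j' /(extE C i0 CA (leqnn _))/elP; exact: minj1.
  have [h1 h2] := stepA i im; split=> [j|[j /(extE C i CA (ltnW im)) ej]].
    rewrite CA // => /h1[ej minj]; split; first exact/(extE C i CA (ltnW im)).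
    by move=> j' /(extE C i CA (ltnW im)); exact: minj.
  by have [|k Ak] := h2; [exists j|exists k; rewrite CA].
- move=> i j mi; rewrite mxE (negbTE (emA _ _ (ltnW mi))) /=.
  by rewrite negb_and; apply/orP; left; apply: contraL mi => /eqP->; rewrite ltnn.
Qed.

(* Main.v *)
(* A reward of [n] makes the assignment a bijection [g] from jobs to workers
   with [alpha <= f (x i) (p (g i))], so [v (g i) <= x i <= u (g i)]; summing
   squares and reindexing along [g] compares the loads. *)

Require Import Defs.
From mathcomp Require Import all_boot all_order all_algebra.
From mathcomp Require Import classical_sets reals.

Set Implicit Arguments.
Unset Strict Implicit.
Unset Printing Implicit Defensive.

Import Order.TTheory GRing.Theory Num.Theory.
Local Open Scope classical_set_scope.
Local Open Scope ring_scope.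

(** Squaring is monotone only on nonnegative reals, hence the lower bound on [y i]. *)
Lemma ler_job_load (R : realType) (n : nat) (y z : 'I_n -> R) :
  (forall i, 0 <= y i <= z i) -> job_load y <= job_load z.
Proof.
move=> yz; rewrite /job_load ler_wsqrtr //; apply: ler_sum => i _.
have /andP[y0 le_yz] := yz i.
by rewrite ler_sqr ?nnegrE // (le_trans y0).
Qed.

Lemma job_load_reindex (R : realType) (n : nat) (g : 'I_n -> 'I_n)
    (y : 'I_n -> R) :
  injective g -> job_load (y \o g) = job_load y.
Proof. by move=> g_inj; rewrite /job_load [in RHS](reindex_inj g_inj). Qed.

(** A sum of [n] indicators equals [n] only if each is 1, so every job has a worker meeting the
    threshold; the column constraint makes the choice of workers injective. *)
Lemma threshold_reward_full (R : realType) (n : nat) (p : 'I_n -> R)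
    (alpha : R) (f : R -> R -> R) (x : 'I_n -> R) (A : 'M[bool]_n) :
  is_assignment A -> threshold_reward p alpha f x A = n ->
  exists2 g : 'I_n -> 'I_n, injective g &
    forall i, alpha <= f (x i) (p (g i)).
Proof.
move=> asA; rewrite /threshold_reward sum_bool_card => full.
have all_served i : served p alpha f x A i.
  have /setP/(_ i) : finset (served p alpha f x A) = [set: 'I_n]%SET.
    by apply/eqP; rewrite eqEcard finset.subsetT cardsT card_ord full /=.
  by rewrite !inE.
have /fin_all_exists[g gP] i : exists j, A i j /\ alpha <= f (x i) (p j).
  exact/(servedP p alpha f x i asA).
exists g => [i i' eq_g|i]; last by have [] := gP i.
have [_ colA] := is_assignmentP _ asA.
(* Jobs [i] and [i'] would both occupy column [g i]. *)
by apply: (colA (g i)); [have [] := gP i | rewrite eq_g; have [] := gP i'].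
Qed.

Theorem mainTheorem2 (R : realType) (n : nat) (n_gt0 : (0 < n)%N)
    (p : 'I_n -> R) (p_rate : forall i, 0 < p i <= 1)
    (alpha : R)
    (Omega : set R) (Omega_pos : Omega `<=` [set y | 0 < y])
    (f : R -> R -> R) (f_op : order_preserving Omega (range p) f)
    (u v : 'I_n -> R)
    (u_max : forall i, is_max [set y | Omega y /\ alpha <= f y (p i)] (u i))
    (v_min : forall i, is_min [set y | Omega y /\ alpha <= f y (p i)] (v i))
    (x : 'I_n -> R) (x_Omega : forall i, Omega (x i))
    (A : 'M[bool]_n) (A_pi_star : pi_star p alpha f x A) :
  threshold_reward p alpha f x A = n ->
  job_load v <= job_load x <= job_load u.
Proof.
move=> full; have [asA _] := A_pi_star.
have [g g_inj gP] := threshold_reward_full asA full.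
(* Job [i] now faces the extremal values of its own worker [g i]: by [gP i], [x i] lies in the set
   whose minimum is [v (g i)] and maximum [u (g i)]. *)
rewrite -(job_load_reindex v g_inj) -(job_load_reindex u g_inj).
apply/andP; split; apply: ler_job_load => i /=; apply/andP; split.
(* The minimum is attained in [Omega], hence positive. *)
- by have [[/Omega_pos/ltW]] := v_min (g i).
- by have [_] := v_min (g i); apply.
- exact/ltW/Omega_pos.
- by have [_] := u_max (g i); apply.
Qed.
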